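(* Let $(Q,w)$ be a non-degenerate quiver with potential, let $k$ be a vertex of $Q$, let $(Q',w')=\mu_k(Q,w)$, and assume that the Jacobian algebras $J(Q,w)$ and $J(Q',w')$ are finite dimensional. Let $\mathcal{A}=\mathrm{mod}\,J(Q,w)$ and $\mathcal{A}'=\mathrm{mod}\,J(Q',w')$, with simple modules $S_1,\dots,S_n$ and $S'_1,\dots,S'_n$ respectively, and let $F_k^+:\mathcal{A}\to\mathcal{A}'$ be the generalized reflection functor. If $N_1,N_2,\dots,N_m$ is a complete forward hom-orthogonal sequence in $\mathcal{A}$ with $N_1=S_k$, then $F_k^+(N_2),\dots,F_k^+(N_m),S'_k$ is a complete forward hom-orthogonal sequence in $\mathcal{A}'$.
   Context: Quivers have finitely many vertices and arrows. Quivers with potential, their mutations $\mu_k$, non-degeneracy and Jacobian algebras are in the sense of Derksen–Weyman–Zelevinsky: a potential $w$ is a (possibly infinite) linear combination of cycles in the completed path algebra of $Q$ over a field $K$, $J(Q,w)$ is the quotient of the completed path algebra by the closure of the ideal generated by the cyclic derivatives of $w$, $\mu_k(Q,w)$ is the reduced part of the premutation of $(Q,w)$ at $k$, and $(Q,w)$ is non-degenerate if every iterated mutation of it has no 2-cycles. Modules are finitely generated, $S_i$ and $S'_i$ being the simples at vertex $i$. For a module $N$, $N^{\perp}=\{X:\mathrm{Hom}(N,X)=0\}$, ${}^{\perp}N=\{X:\mathrm{Hom}(X,N)=0\}$, and $\mathcal{G}(N)={}^{\perp}(N^{\perp})=\{X:\mathrm{Hom}(X,Y)=0\ \forall Y\in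 N^{\perp}\}$. $\langle S_k\rangle$ (resp. $\langle S'_k\rangle$) is the full subcategory of direct sums of copies of $S_k$ (resp. $S'_k$). Generalized reflection functors: by results of Buan–Iyama–Reiten–Smith and Mou there are additive functors $F_k^+:\mathcal{A}\to\mathcal{A}'$ and $F_k^-:\mathcal{A}'\to\mathcal{A}$ such that: (1) $F_k^+$ is right exact, $F_k^-$ is left exact, and they are adjoint to each other; (2) $F_k^+(\langle S_k\rangle)=0$ and $F_k^-(\langle S'_k\rangle)=0$; (3) $F_k^+(S_k^{\perp})\subset{}^{\perp}S'_k$ and $F_k^-({}^{\perp}S'_k)\subset S_k^{\perp}$; (4) the restrictions $F_k^+:S_k^{\perp}\to{}^{\perp}S'_k$ and $F_k^-:{}^{\perp}S'_k\to S_k^{\perp}$ are inverse equivalences and preserve short exact sequences. A brick is an object whose endomorphism ring is a division ring. A complete forward hom-orthogonal sequence in an abelian length category $\mathcal{B}$ (one in which every object has finite length) is a finite sequence of bricks $N_1,\dots,N_m$ such that (i) $\mathrm{Hom}(N_i,N_j)=0$ for all $1\le i<j\le m$; (ii) the sequence is maximal in $\mathcal{G}(N)$, where $N=N_1\oplus\cdots\oplus N_m$, meaning that no other bricks (of $\mathcal{G}(N)$) can be inserted into the sequence (at any position) preserving (i); (iii) $\mathcal{G}(N)=\mathcal{B}$. *)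

(* Defs.v *)
From HB Require Import structures.
From mathcomp Require Import all_boot all_algebra.
From mathcomp Require Import generic_quotient ring_quotient.
From mathcomp Require Import boolp.
From Stdlib Require List.

Set Implicit Arguments.
Unset Strict Implicit.
Unset Printing Implicit Defensive.

Import GRing.Theory.
Local Open Scope ring_scope.
Local Open Scope quotient_scope.

(** * Quivers and paths *)

Record quiver (V : finType) := Quiver {
  arrow :> finType;
  src : arrow -> V;
  tgt : arrow -> V }.

Section Paths.
Variables (V : finType) (Q : quiver V).

(* Words are written as in Derksen-Weyman-Zelevinsky, i.e., composed from right
   to left: the word a1 a2 .. ad is a path when src a_i = tgt a_(i+1); it goes
   from src ad to tgt a1. A path is a pair (v, l) where l is its word and v is
   the vertex at which it ends (so (v, [::]) is the trivial path at v). *)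
Fixpoint is_path (v : V) (l : seq Q) : bool :=
  if l is a :: l' then (tgt a == v) && is_path (src a) l' else true.

Definition path_src (v : V) (l : seq Q) : V := last v (map (@src V Q) l).

Record qpath := QPath { pval : V * seq Q; pvalP : is_path pval.1 pval.2 }.

HB.instance Definition _ := [isSub for pval].
HB.instance Definition _ := [Choice of qpath by <:].

Definition pend (p : qpath) : V := (pval p).1.
Definition pword (p : qpath) : seq Q := (pval p).2.
Definition pstart (p : qpath) : V := path_src (pend p) (pword p).
Definition plen (p : qpath) : nat := size (pword p).

Lemma is_path_take v l i : is_path v l -> is_path v (take i l).
Proof.
by elim: l v i => [|a l IHl] v [|i] //= /andP[-> /IHl->].
Qed.

Lemma is_path_drop v l i :
  is_path v l -> is_path (path_src v (take i l)) (drop i l).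
Proof.
elim: l v i => [|a l IHl] v [|i] //= /andP[_ /IHl]; exact.
Qed.

(* p = (ptake i p) (pdrop i p), where ptake i p consists of the i leftmost
   letters of p *)
Definition ptake (i : nat) (p : qpath) : qpath :=
  @QPath (pend p, take i (pword p)) (is_path_take i (pvalP p)).

Definition pdrop (i : nat) (p : qpath) : qpath :=
  @QPath (path_src (pend p) (take i (pword p)), drop i (pword p))
    (is_path_drop i (pvalP p)).

Lemma qpath_eq (p q : qpath) : pend p = pend q -> pword p = pword q -> p = q.
Proof.
move=> e1 e2; apply: val_inj; move: e1 e2; rewrite /pend /pword /=.
by case: (pval p) (pval q) => [? ?] [? ?] /= -> ->.
Qed.

Lemma plen_take i p : (i <= plen p)%N -> plen (ptake i p) = i.
Proof. by move=> ip; rewrite /plen /ptake /pword /= size_takel. Qed.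

Lemma plen_drop i p : plen (pdrop i p) = (plen p - i)%N.
Proof. by rewrite /plen /pdrop /pword /= size_drop. Qed.

Lemma ptake_take i j p : (i <= j)%N -> ptake i (ptake j p) = ptake i p.
Proof. by move=> ij; apply: qpath_eq => //; rewrite /pword /= take_takel. Qed.

Lemma path_src_cat v l1 l2 :
  path_src v (l1 ++ l2) = path_src (path_src v l1) l2.
Proof. by rewrite /path_src map_cat last_cat. Qed.

Lemma pdrop_drop i j p : pdrop j (pdrop i p) = pdrop (i + j) p.
Proof.
apply: qpath_eq; rewrite /pend /pword /=; last by rewrite drop_drop addnC.
by rewrite -path_src_cat takeD.
Qed.

Lemma ptake_drop i j p : ptake j (pdrop i p) = pdrop i (ptake (i + j) p).
Proof.
apply: qpath_eq; rewrite /pend /pword /=.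
  by rewrite take_takel // leq_addr.
by rewrite take_drop addnC.
Qed.

Definition no_loops : Prop := forall a : Q, src a <> tgt a.

Definition no_2cycles : Prop :=
  forall a b : Q, ~ (src a = tgt b /\ tgt a = src b).

Definition no_2cycles_at (k : V) : Prop :=
  forall a b : Q, src a = k -> ~ (src a = tgt b /\ tgt a = src b).

End Paths.

(** * The completed path algebra *)

(* Arbitrary, possibly infinite, linear combinations of paths *)
Definition cpa (K : fieldType) (V : finType) (Q : quiver V) : Type :=
  qpath Q -> K.

HB.instance Definition _ K V Q := Choice.copy (@cpa K V Q) (qpath Q -> K).

Section CompletedPathAlgebra.
Variables (K : fieldType) (V : finType) (Q : quiver V).
Local Notation A := (cpa K Q).
Implicit Types (f g h w : A) (p : qpath Q).

Definition cpa_zero : A := fun=> 0.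
Definition cpa_opp f : A := fun p => - f p.
Definition cpa_add f g : A := fun p => f p + g p.
Definition cpa_scale (c : K) f : A := fun p => c * f p.
Definition cpa_one : A := fun p => (plen p == 0)%:R.
Definition cpa_mul f g : A :=
  fun p => \sum_(i < (plen p).+1) f (ptake i p) * g (pdrop i p).

Fact cpa_addA : associative cpa_add.
Proof. by move=> f g h; apply: funext => p; apply: addrA. Qed.
Fact cpa_addC : commutative cpa_add.
Proof. by move=> f g; apply: funext => p; apply: addrC. Qed.
Fact cpa_add0 : left_id cpa_zero cpa_add.
Proof. by move=> f; apply: funext => p; apply: add0r. Qed.
Fact cpa_addN : left_inverse cpa_zero cpa_opp cpa_add.
Proof. by move=> f; apply: funext => p; apply: addNr. Qed.

HB.instance Definition _ :=
  GRing.isZmodule.Build A cpa_addA cpa_addC cpa_add0 cpa_addN.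

Fact cpa_scaleA a b f : cpa_scale a (cpa_scale b f) = cpa_scale (a * b) f.
Proof. by apply: funext => p; apply: mulrA. Qed.
Fact cpa_scale1 : left_id 1 cpa_scale.
Proof. by move=> f; apply: funext => p; apply: mul1r. Qed.
Fact cpa_scaleDr : right_distributive cpa_scale +%R.
Proof. by move=> a f g; apply: funext => p; apply: mulrDr. Qed.
Fact cpa_scaleDl f : {morph cpa_scale^~ f : a b / a + b}.
Proof. by move=> a b; apply: funext => p; apply: mulrDl. Qed.

HB.instance Definition _ :=
  GRing.Zmodule_isLmodule.Build K A cpa_scaleA cpa_scale1 cpa_scaleDr
    cpa_scaleDl.

Lemma cpa0E p : (0 : A) p = 0. Proof. by []. Qed.
Lemma cpaDE f g p : (f + g) p = f p + g p. Proof. by []. Qed.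
Lemma cpaNE f p : (- f) p = - f p. Proof. by []. Qed.
Lemma cpaZE (c : K) f p : (c *: f) p = c * f p. Proof. by []. Qed.

Fact cpa_mulA : associative cpa_mul.
Proof.
move=> f g h; apply: funext => p; rewrite /cpa_mul.
set n := plen p.
pose F (i j : nat) := f (ptake i p) * g (pdrop i (ptake j p)) * h (pdrop j p).
transitivity (\sum_(i < n.+1) \sum_(j < n.+1 | (i <= j)%N) F i j).
  apply: eq_bigr => i _; rewrite mulr_sumr plen_drop -/n.
  have ile : (i <= n)%N by rewrite -ltnS.
  transitivity (\sum_(i <= j < n.+1) F i j); last first.
    rewrite (big_nat_widenl i 0) ?leq0n // big_mkord.
    by apply: eq_bigl.
  rewrite -[X in index_iota X _](add0n i) big_addn subSn // big_mkord.
  apply: eq_bigr => j _; rewrite /F mulrA pdrop_drop ptake_drop.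
  by rewrite [(j + i)%N]addnC.
rewrite (exchange_big_dep predT) //=; apply: eq_bigr => j _.
rewrite mulr_suml.
have jle : (j <= plen p)%N by rewrite -ltnS.
rewrite plen_take //.
transitivity (\sum_(0 <= i < n.+1 | (i <= j)%N) F i j).
  by rewrite big_mkord.
transitivity (\sum_(0 <= i < j.+1) F i j); last first.
  rewrite big_mkord; apply: eq_bigr => i _; rewrite /F ptake_take //.
  by rewrite -ltnS.
by rewrite [RHS](big_nat_widen 0 j.+1 n.+1).
Qed.

Fact cpa_mul1 : left_id cpa_one cpa_mul.
Proof.
move=> f; apply: funext => p; rewrite /cpa_mul big_ord_recl /= /cpa_one.
rewrite plen_take //= mul1r big1 ?addr0 => [|i _].
  by congr f; apply: qpath_eq; rewrite /pend /pword /= ?take0 ?drop0.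
by rewrite plen_take //= mul0r.
Qed.

Fact cpa_mulr1 : right_id cpa_one cpa_mul.
Proof.
move=> f; apply: funext => p; rewrite /cpa_mul big_ord_recr /= /cpa_one.
rewrite plen_drop subnn eqxx mulr1 big1 ?add0r => [|i _].
  by congr f; apply: qpath_eq; rewrite /pend /pword /= ?take_size.
by rewrite plen_drop subn_eq0 leqNgt ltn_ord /= mulr0.
Qed.

Fact cpa_mulDl : left_distributive cpa_mul +%R.
Proof.
move=> f g h; apply: funext => p; rewrite cpaDE /cpa_mul -big_split.
by apply: eq_bigr => i _; rewrite cpaDE mulrDl.
Qed.

Fact cpa_mulDr : right_distributive cpa_mul +%R.
Proof.
move=> f g h; apply: funext => p; rewrite cpaDE /cpa_mul -big_split.
by apply: eq_bigr => i _; rewrite cpaDE mulrDr.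
Qed.

HB.instance Definition _ :=
  GRing.Zmodule_isPzRing.Build A cpa_mulA cpa_mul1 cpa_mulr1 cpa_mulDl
    cpa_mulDr.

Lemma cpaME f g p :
  (f * g) p = \sum_(i < (plen p).+1) f (ptake i p) * g (pdrop i p).
Proof. by []. Qed.

Lemma cpa1E p : (1 : A) p = (plen p == 0)%:R. Proof. by []. Qed.

Lemma cpa_scalerAl (c : K) f g : c *: (f * g) = (c *: f) * g.
Proof.
apply: funext => p; rewrite cpaZE !cpaME mulr_sumr.
by apply: eq_bigr => i _; rewrite cpaZE mulrA.
Qed.

Lemma cpa_scalerAr (c : K) f g : c *: (f * g) = f * (c *: g).
Proof.
apply: funext => p; rewrite cpaZE !cpaME mulr_sumr.
by apply: eq_bigr => i _; rewrite cpaZE mulrCA.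
Qed.

(* The basis element given by the word l ending at v, or 0 if l is not a path *)
Definition mono (v : V) (l : seq Q) : A := fun p => (pval p == (v, l))%:R.

Definition idem (v : V) : A := mono v [::].

Definition coef f (v : V) (l : seq Q) : K := oapp f 0 (insub (v, l)).

(* Closure in the m-adic topology, m being the ideal generated by the arrows:
   m^d consists of the combinations of paths of length at least d. *)
Definition mclosure (I : A -> Prop) (x : A) : Prop :=
  forall d : nat, exists2 y, I y & forall p, (plen p < d)%N -> x p = y p.

Definition is_cycle p : bool := (pword p != [::]) && (pstart p == pend p).

Definition is_potential w : Prop := forall p, w p != 0 -> is_cycle p.

Definition is_cyclic_word (l : seq Q) : bool :=
  if l is a :: l' then is_path (tgt a) l && (path_src (tgt a) l == tgt a)
  else false.

(* a1 a2 .. ad - a2 .. ad a1 *)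
Definition rot_diff (l : seq Q) : A :=
  if l is a :: l' then mono (tgt a) l - mono (src a) (rcons l' a) else 0.

Definition rot_span (x : A) : Prop :=
  exists2 s : seq (K * seq Q), all (fun t => is_cyclic_word t.2) s &
    x = \sum_(t <- s) t.1 *: rot_diff t.2.

Definition cyc_equiv f g : Prop := mclosure rot_span (f - g).

(* The cyclic derivative with respect to a sends a1 .. ad to the sum of the
   a_(i+1) .. ad a1 .. a_(i-1) over all i such that a_i = a; hence the
   coefficient at l of the derivative of w collects the coefficients in w of
   the rotations of the cycle a l, once for each position of the marked a. *)
Definition cderiv w (a : Q) : A := fun p =>
  if (pend p == src a) && (pstart p == tgt a) then
    \sum_(i < (plen p).+1)
      let r := rot i (a :: pword p) in coef w (tgt (head a r)) r
  else 0.

Definition homog (d : nat) w : A := fun p => if plen p == d then w p else 0.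

(** * The Jacobian algebra *)

Definition cderiv_ideal w (x : A) : Prop :=
  exists s : seq (A * Q * A),
    x = \sum_(t <- s) t.1.1 * cderiv w t.1.2 * t.2.

Definition jac_ideal w : {pred A} := fun x => `[< mclosure (cderiv_ideal w) x >].

Lemma jac_idealP w x :
  reflect (mclosure (cderiv_ideal w) x) (x \in jac_ideal w).
Proof. exact: asboolP. Qed.

Lemma cderiv_idealB w x y :
  cderiv_ideal w x -> cderiv_ideal w y -> cderiv_ideal w (x - y).
Proof.
move=> [s ->] [t ->]; exists (s ++ [seq (- u.1.1, u.1.2, u.2) | u <- t]).
rewrite big_cat big_map /= -sumrN; congr (_ + _).
by apply: eq_bigr => u _; rewrite !mulNr.
Qed.

Lemma cderiv_idealMl w u x : cderiv_ideal w x -> cderiv_ideal w (u * x).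
Proof.
move=> [s ->]; exists [seq (u * t.1.1, t.1.2, t.2) | t <- s].
by rewrite big_map mulr_sumr; apply: eq_bigr => t _; rewrite /= !mulrA.
Qed.

Lemma cderiv_idealMr w u x : cderiv_ideal w x -> cderiv_ideal w (x * u).
Proof.
move=> [s ->]; exists [seq (t.1.1, t.1.2, t.2 * u) | t <- s].
by rewrite big_map mulr_suml; apply: eq_bigr => t _; rewrite /= !mulrA.
Qed.

Fact jac_ideal_zmod_closed w : zmod_closed (jac_ideal w).
Proof.
split=> [|x y /jac_idealP xI /jac_idealP yI]; apply/jac_idealP => d.
  by exists 0 => //; exists [::]; rewrite big_nil.
have [x' x'I xx'] := xI d; have [y' y'I yy'] := yI d.
exists (x' - y'); first exact: cderiv_idealB.
by move=> p pd; rewrite !cpaDE !cpaNE xx' ?yy'.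
Qed.

HB.instance Definition _ w :=
  GRing.isZmodClosed.Build A (jac_ideal w) (jac_ideal_zmod_closed w).

Lemma jac_idealMl w u x : x \in jac_ideal w -> u * x \in jac_ideal w.
Proof.
move=> /jac_idealP xI; apply/jac_idealP => d.
have [x' x'I xx'] := xI d; exists (u * x'); first exact: cderiv_idealMl.
move=> p pd; rewrite !cpaME; apply: eq_bigr => i _; congr (_ * _).
by apply: xx'; rewrite plen_drop (leq_ltn_trans (leq_subr _ _)).
Qed.

Lemma jac_idealMr w u x : x \in jac_ideal w -> x * u \in jac_ideal w.
Proof.
move=> /jac_idealP xI; apply/jac_idealP => d.
have [x' x'I xx'] := xI d; exists (x' * u); first exact: cderiv_idealMr.
move=> p pd; rewrite !cpaME; apply: eq_bigr => i _; congr (_ * _).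
have ip : (i <= plen p)%N by rewrite -ltnS.
by apply: xx'; rewrite plen_take // (leq_ltn_trans ip).
Qed.

Lemma jac_idealZ w (c : K) x : x \in jac_ideal w -> c *: x \in jac_ideal w.
Proof. by rewrite -[x]mul1r cpa_scalerAl => /jac_idealMl; rewrite mul1r; apply. Qed.

Variable w : A.

Definition jacobian : Type := {ideal_quot (jac_ideal w)}.
HB.instance Definition _ := GRing.Zmodule.on jacobian.

Definition jac_pi (x : A) : jacobian := \pi_({ideal_quot (jac_ideal w)}) x.
Definition jac_repr (x : jacobian) : A := repr (x : {ideal_quot (jac_ideal w)}).

Lemma jac_reprK : cancel jac_repr jac_pi.
Proof. by move=> x; rewrite /jac_pi /jac_repr reprK. Qed.

Lemma jac_piP x y : reflect (jac_pi x = jac_pi y) (x - y \in jac_ideal w).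
Proof. by rewrite Quotient.idealrBE; apply: eqP. Qed.

Lemma jac_piD x y : jac_pi (x + y) = jac_pi x + jac_pi y.
Proof. by rewrite /jac_pi raddfD. Qed.

Lemma jac_repr_pi x : jac_repr (jac_pi x) - x \in jac_ideal w.
Proof. by apply/jac_piP; rewrite jac_reprK. Qed.

Definition jac_one : jacobian := jac_pi 1.
Definition jac_mul (x y : jacobian) : jacobian :=
  jac_pi (jac_repr x * jac_repr y).
Definition jac_scale (c : K) (x : jacobian) : jacobian :=
  jac_pi (c *: jac_repr x).

Lemma jac_mul_pi x y : jac_mul (jac_pi x) (jac_pi y) = jac_pi (x * y).
Proof.
apply/jac_piP; rewrite -[_ * _](addrNK (x * jac_repr (jac_pi y))) -mulrBl.
rewrite -addrA -mulrBr rpredD //.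
  by apply/jac_idealMr/jac_repr_pi.
by apply/jac_idealMl/jac_repr_pi.
Qed.

Lemma jac_scale_pi c x : jac_scale c (jac_pi x) = jac_pi (c *: x).
Proof. by apply/jac_piP; rewrite -scalerBr; apply/jac_idealZ/jac_repr_pi. Qed.

Fact jac_mulA : associative jac_mul.
Proof.
move=> x y z; rewrite -[x]jac_reprK -[y]jac_reprK -[z]jac_reprK.
by rewrite !jac_mul_pi mulrA.
Qed.
Fact jac_mul1 : left_id jac_one jac_mul.
Proof. by move=> x; rewrite -[x]jac_reprK jac_mul_pi mul1r. Qed.
Fact jac_mulr1 : right_id jac_one jac_mul.
Proof. by move=> x; rewrite -[x]jac_reprK jac_mul_pi mulr1. Qed.
Fact jac_mulDl : left_distributive jac_mul +%R.
Proof.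
move=> x y z; rewrite -[x]jac_reprK -[y]jac_reprK -[z]jac_reprK.
by rewrite -jac_piD !jac_mul_pi -jac_piD mulrDl.
Qed.
Fact jac_mulDr : right_distributive jac_mul +%R.
Proof.
move=> x y z; rewrite -[x]jac_reprK -[y]jac_reprK -[z]jac_reprK.
by rewrite -jac_piD !jac_mul_pi -jac_piD mulrDr.
Qed.

HB.instance Definition _ :=
  GRing.Zmodule_isPzRing.Build jacobian jac_mulA jac_mul1 jac_mulr1 jac_mulDl
    jac_mulDr.

Lemma jac_piM x y : jac_pi (x * y) = jac_pi x * jac_pi y.
Proof. by rewrite -jac_mul_pi. Qed.

Lemma jac_pi1 : jac_pi 1 = 1. Proof. by []. Qed.

Fact jac_scaleA a b x : jac_scale a (jac_scale b x) = jac_scale (a * b) x.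
Proof. by rewrite -[x]jac_reprK !jac_scale_pi scalerA. Qed.
Fact jac_scale1 : left_id 1 jac_scale.
Proof. by move=> x; rewrite -[x]jac_reprK jac_scale_pi scale1r. Qed.
Fact jac_scaleDr : right_distributive jac_scale +%R.
Proof.
move=> a x y; rewrite -[x]jac_reprK -[y]jac_reprK.
by rewrite -jac_piD !jac_scale_pi -jac_piD scalerDr.
Qed.
Fact jac_scaleDl x : {morph jac_scale^~ x : a b / a + b}.
Proof.
by move=> a b; rewrite -[x]jac_reprK !jac_scale_pi -jac_piD scalerDl.
Qed.

HB.instance Definition _ :=
  GRing.Zmodule_isLmodule.Build K jacobian jac_scaleA jac_scale1 jac_scaleDr
    jac_scaleDl.

Lemma jac_piZ c x : jac_pi (c *: x) = c *: jac_pi x.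
Proof. by rewrite -jac_scale_pi. Qed.

End CompletedPathAlgebra.
Arguments mono K {V Q} v l.
Arguments idem K {V} Q v.

(** * Quivers with potential *)

Record QP (K : fieldType) (V : finType) := MkQP {
  qp_quiver :> quiver V;
  qp_pot : cpa K qp_quiver;
  qp_no_loops : no_loops qp_quiver;
  qp_potP : is_potential qp_pot }.
Arguments qp_pot {K V} q.

Notation "''J' ( P )" := (jacobian (qp_pot P)) (format "''J' ( P )").

Section Mutation.
Variables (K : fieldType) (V : finType).

(** ** Direct sums, trivial and reduced quivers with potential *)

Definition dsum_quiver (Q1 Q2 : quiver V) : quiver V :=
  @Quiver V (Q1 + Q2)%type
    (fun a => match a with inl a => src a | inr a => src a end)
    (fun a => match a with inl a => tgt a | inr a => tgt a end).

Definition getl (T U : Type) (x : T + U) : option T :=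
  if x is inl y then Some y else None.
Definition getr (T U : Type) (x : T + U) : option U :=
  if x is inr y then Some y else None.

Definition dsum_pot (Q1 Q2 : quiver V) (w1 : cpa K Q1) (w2 : cpa K Q2) :
    cpa K (dsum_quiver Q1 Q2) := fun p =>
  (if all (fun a => isSome (getl a)) (pword p)
   then coef w1 (pend p) (pmap (@getl Q1 Q2) (pword p)) else 0) +
  (if all (fun a => isSome (getr a)) (pword p)
   then coef w2 (pend p) (pmap (@getr Q1 Q2) (pword p)) else 0).

Definition trivial_QP (P : QP K V) : Prop :=
  homog 2 (qp_pot P) = qp_pot P /\
  forall b : P, exists c : P -> K,
    mono K (tgt b) [:: b] = \sum_(a : P) c a *: cderiv (qp_pot P) a.

(* The trivial part, i.e., the span of the cyclic derivatives of the degree 2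
   component of the potential, is zero. *)
Definition reduced_QP (P : QP K V) : Prop :=
  forall a : P, cderiv (homog 2 (qp_pot P)) a = 0.

Definition right_equiv (Q1 Q2 : quiver V) (w1 : cpa K Q1) (w2 : cpa K Q2) :
    Prop :=
  exists phi : {rmorphism cpa K Q1 -> cpa K Q2},
    [/\ scalable phi, bijective phi,
        (forall v, phi (idem K Q1 v) = idem K Q2 v) &
        cyc_equiv (phi w1) w2].

(** ** Premutation *)

Section Premutation.
Variables (Q : quiver V) (k : V).

(* The arrows a not incident to k, the composites [ba] of a : i -> k and
   b : k -> j, and the opposites a^* of the arrows a incident to k *)
Definition premut_arrow : finType :=
  ({a : Q | (src a != k) && (tgt a != k)} +
   {ba : Q * Q | (src ba.1 == k) && (tgt ba.2 == k)} +
   {a : Q | (src a == k) || (tgt a == k)})%type.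

Definition premut_src (x : premut_arrow) : V :=
  match x with
  | inl (inl a) => src (val a)
  | inl (inr ba) => src (val ba).2
  | inr a => tgt (val a)
  end.

Definition premut_tgt (x : premut_arrow) : V :=
  match x with
  | inl (inl a) => tgt (val a)
  | inl (inr ba) => tgt (val ba).1
  | inr a => src (val a)
  end.

Definition premut_quiver : quiver V := Quiver premut_src premut_tgt.

Definition starred (x : premut_arrow) : bool := if x is inr _ then true else false.

Definition unbracket (x : premut_arrow) : seq Q :=
  match x with
  | inl (inl a) => [:: val a]
  | inl (inr ba) => [:: (val ba).1; (val ba).2]
  | inr _ => [::]
  end.

(* [S], obtained from S by replacing each factor ba through k by [ba]: since
   unbracketing is injective on paths without starred arrows, the coefficient
   of [S] at such a path is that of S at the unbracketed one. This is meant for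
   an S in which no cycle starts at k. *)
Definition bracket_pot (S : cpa K Q) : cpa K premut_quiver := fun p =>
  if all (predC starred) (pword p)
  then coef S (pend p) (flatten (map unbracket (pword p))) else 0.

(* The sum of the [ba] a^* b^* *)
Definition delta_pot : cpa K premut_quiver := fun p =>
  match pword p with
  | [:: inl (inr ba); inr a; inr b] =>
      ((val a == (val ba).2) && (val b == (val ba).1))%:R
  | _ => 0
  end.

Definition premut_pot (S : cpa K Q) : cpa K premut_quiver :=
  bracket_pot S + delta_pot.

End Premutation.
Arguments premut_pot {Q} k S.

(** ** Mutation *)

(* The mutation at k is the reduced part of the premutation, which is given by
   the splitting theorem and well-defined up to right-equivalence only; hence
   is_mutation k P P' is a relation, stating that P' is (a representative of)
   the mutation of P at k. As usual, the potential of P is first replaced by a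
   cyclically equivalent one, S, in which no cycle starts at k. *)
Definition is_mutation (k : V) (P P' : QP K V) : Prop :=
  no_2cycles_at P k /\
  exists S : cpa K P,
    [/\ is_potential S, cyc_equiv S (qp_pot P),
        (forall p, S p != 0 -> pstart p <> k), reduced_QP P' &
        exists2 C : QP K V, trivial_QP C &
          right_equiv (premut_pot k S) (dsum_pot (qp_pot P') (qp_pot C))].

Inductive iter_mutation (P : QP K V) : QP K V -> Prop :=
  | iter_mutation0 : iter_mutation P P
  | iter_mutationS (k : V) (P1 P2 : QP K V) :
      iter_mutation P P1 -> is_mutation k P1 P2 -> iter_mutation P P2.

Definition nondegenerate_QP (P : QP K V) : Prop :=
  forall P', iter_mutation P P' -> no_2cycles P'.

End Mutation.

(** * Finitely generated modules *)

(* Over a field this is finite dimensionality. *)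
Definition finitely_generated (R : pzRingType) (M : lmodType R) : Prop :=
  exists (n : nat) (g : 'I_n -> M),
    forall x, exists c : 'I_n -> R, x = \sum_i c i *: g i.

Record fgmod (R : pzRingType) := FGMod {
  fgmod_sort :> lmodType R;
  fgmodP : finitely_generated fgmod_sort }.

Section Modules.
Variable R : pzRingType.
Implicit Types (X Y Z M N : fgmod R).

Lemma zero_fg : finitely_generated 'rV[R]_0.
Proof.
exists 0%N, (fun=> 0) => x; exists (fun=> 0).
by rewrite big_ord0; apply/rowP => -[].
Qed.

Definition fg_zero : fgmod R := FGMod zero_fg.

Lemma dsum_fg M N : finitely_generated (M * N)%type.
Proof.
have [m [g gP]] := fgmodP M; have [n [h hP]] := fgmodP N.
exists (m + n)%N.
exists (fun i => match split i with inl i => (g i, 0) | inr i => (0, h i) end).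
case=> x y; have [c cE] := gP x; have [d dE] := hP y.
exists (fun i => match split i with inl i => c i | inr i => d i end).
rewrite big_split_ord /=.
under eq_bigr => i _ do rewrite (unsplitK (inl i)).
under [X in _ + X]eq_bigr => i _ do rewrite (unsplitK (inr i)).
rewrite [LHS]surjective_pairing [RHS]surjective_pairing /= cE dE.
congr pair; rewrite !raddf_sum /=.
  by rewrite [X in _ + X]big1 ?addr0 // => i _; rewrite scaler0.
by rewrite [X in X + _]big1 ?add0r // => i _; rewrite scaler0.
Qed.

Definition fg_dsum M N : fgmod R := FGMod (dsum_fg M N).

Definition fg_bigdsum (s : seq (fgmod R)) : fgmod R := foldr fg_dsum fg_zero s.

Definition fg_iso X Y : Prop := exists f : {linear X -> Y}, bijective f.

Definition fg_eq0 X : Prop := forall x : X, x = 0.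

Definition hom0 X Y : Prop := forall (f : {linear X -> Y}) x, f x = 0.

(* N^perp and ^perp N *)
Definition rperp N : fgmod R -> Prop := fun X => hom0 N X.
Definition lperp N : fgmod R -> Prop := fun X => hom0 X N.

(* G(N) = ^perp (N^perp) *)
Definition tors N : fgmod R -> Prop := fun X => forall Y, rperp N Y -> hom0 X Y.

(* Direct sums of copies of N *)
Definition copies N : fgmod R -> Prop :=
  fun X => exists r : nat, fg_iso X (fg_bigdsum (nseq r N)).

(* End(M) is a division ring *)
Definition brick M : Prop :=
  (exists x : M, x != 0) /\
  forall f : {linear M -> M}, (exists x, f x != 0) ->
    exists g : {linear M -> M}, cancel f g /\ cancel g f.

Definition hom_orthogonal (s : seq (fgmod R)) : Prop :=
  List.ForallOrdPairs hom0 s.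

Definition complete_fho (s : seq (fgmod R)) : Prop :=
  let N := fg_bigdsum s in
  [/\ List.Forall brick s, hom_orthogonal s,
      (forall s1 s2 B, s = s1 ++ s2 -> brick B -> tors N B ->
         ~ hom_orthogonal (s1 ++ B :: s2)) &
      forall X, tors N X].

Definition exact_at X Y Z (f : {linear X -> Y}) (g : {linear Y -> Z}) : Prop :=
  forall y, g y = 0 <-> exists x, f x = y.

Definition surj X Y (f : {linear X -> Y}) : Prop := forall y, exists x, f x = y.

End Modules.

(** * Generalized reflection functors *)

Record add_functor (R R' : pzRingType) := AddFunctor {
  fobj :> fgmod R -> fgmod R';
  fmap : forall X Y : fgmod R, {linear X -> Y} -> {linear fobj X -> fobj Y};
  fmap_id : forall X : fgmod R, fmap (idfun : {linear X -> X}) =1 idfun;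
  fmap_comp : forall (X Y Z : fgmod R) (g : {linear Y -> Z})
      (f : {linear X -> Y}),
    fmap (g \o f : {linear X -> Z}) =1 fmap g \o fmap f;
  fmap_add : forall (X Y : fgmod R) (f g : {linear X -> Y}),
    fmap (f \+ g : {linear X -> Y}) =1 fmap f \+ fmap g }.

Section Functors.
Variables (R R' : pzRingType).

Definition right_exact (F : add_functor R R') : Prop :=
  forall (X Y Z : fgmod R) (f : {linear X -> Y}) (g : {linear Y -> Z}),
    exact_at f g -> surj g -> exact_at (fmap F f) (fmap F g) /\ surj (fmap F g).

Definition left_exact (F : add_functor R R') : Prop :=
  forall (X Y Z : fgmod R) (f : {linear X -> Y}) (g : {linear Y -> Z}),
    injective f -> exact_at f g ->
    injective (fmap F f) /\ exact_at (fmap F f) (fmap F g).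

Definition left_adjoint (F : add_functor R R') (G : add_functor R' R) : Prop :=
  exists phi : forall (X : fgmod R) (Y : fgmod R'),
      {linear F X -> Y} -> {linear X -> G Y},
    (forall X Y, bijective (phi X Y)) /\
    (forall (X1 X2 : fgmod R) (Y1 Y2 : fgmod R') (f : {linear X2 -> X1})
        (g : {linear Y1 -> Y2}) (h : {linear F X1 -> Y1}),
      phi X2 Y2 (g \o h \o fmap F f : {linear F X2 -> Y2})
        =1 fmap G g \o phi X1 Y1 h \o f).

Definition maps_into (F : add_functor R R') (C : fgmod R -> Prop)
    (C' : fgmod R' -> Prop) : Prop := forall X, C X -> C' (F X).

Definition preserves_ses_on (F : add_functor R R') (C : fgmod R -> Prop) : Prop :=
  forall (X Y Z : fgmod R) (f : {linear X -> Y}) (g : {linear Y -> Z}),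
    C X -> C Y -> C Z -> injective f -> exact_at f g -> surj g ->
    [/\ injective (fmap F f), exact_at (fmap F f) (fmap F g) &
        surj (fmap F g)].

(* The composite G F is naturally isomorphic to the identity on C. *)
Definition natural_retract (F : add_functor R R') (G : add_functor R' R)
    (C : fgmod R -> Prop) : Prop :=
  exists eta : forall X : fgmod R, {linear X -> G (F X)},
    (forall X, C X -> bijective (eta X)) /\
    (forall (X Y : fgmod R) (f : {linear X -> Y}), C X -> C Y ->
      eta Y \o f =1 fmap G (fmap F f) \o eta X).

End Functors.

Record reflection_functors (R R' : pzRingType) (S : fgmod R) (S' : fgmod R')
    (F : add_functor R R') (G : add_functor R' R) : Prop := ReflectionFunctors {
  refl_right_exact : right_exact F;
  refl_left_exact : left_exact G;
  refl_adjoint : left_adjoint F G;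
  refl_copies : maps_into F (copies S) (@fg_eq0 R');
  refl_copies' : maps_into G (copies S') (@fg_eq0 R);
  refl_perp : maps_into F (rperp S) (lperp S');
  refl_perp' : maps_into G (lperp S') (rperp S);
  refl_inv : natural_retract F G (rperp S);
  refl_inv' : natural_retract G F (lperp S');
  refl_ses : preserves_ses_on F (rperp S);
  refl_ses' : preserves_ses_on G (lperp S') }.

(** * The simple modules of a Jacobian algebra *)

(* The one-dimensional module on which x acts by its coefficient at the trivial
   path at k *)
Definition simple_sort (K : fieldType) (V : finType) (P : QP K V) (k : V) :
  Type := K.

Section Simples.
Variables (K : fieldType) (V : finType) (P : QP K V) (k : V).
Local Notation A := (cpa K P).
Local Notation Sk := (simple_sort P k).

HB.instance Definition _ := GRing.Zmodule.copy Sk K.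

Definition trivial_path : qpath P := @QPath V P (k, [::]) isT.

Definition simple_scale (x : 'J(P)) (c : Sk) : Sk :=
  (jac_repr x trivial_path : K) * (c : K).

Lemma cpa_triv_mul (x y : A) :
  (x * y) trivial_path = x trivial_path * y trivial_path.
Proof.
rewrite cpaME big_ord_recl big_ord0 addr0.
by congr (x _ * y _); apply: qpath_eq.
Qed.

Lemma cderiv_triv (w : A) (a : P) (p : qpath P) : plen p = 0 -> cderiv w a p = 0.
Proof.
rewrite /cderiv /pstart /path_src => /size0nil -> /=.
case: ifP => // /andP[/eqP e1 /eqP e2].
by case: (@qp_no_loops K V P a); rewrite -e1 e2.
Qed.

Lemma jac_ideal_triv (x : A) : x \in jac_ideal (qp_pot P) -> x trivial_path = 0.
Proof.
move=> /jac_idealP /(_ 1) [_ [s ->]] -> //.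
elim/big_rec: _ => // t y _; rewrite cpaDE => ->; rewrite addr0.
by rewrite !cpa_triv_mul cderiv_triv // mulr0 mul0r.
Qed.

Lemma jac_repr_triv (x : A) :
  jac_repr (jac_pi (qp_pot P) x) trivial_path = x trivial_path.
Proof.
have := jac_ideal_triv (jac_repr_pi (qp_pot P) x).
by rewrite cpaDE cpaNE => /eqP; rewrite subr_eq0 => /eqP.
Qed.

Lemma simple_scale_pi (x : A) c :
  simple_scale (jac_pi (qp_pot P) x) c = (x trivial_path : K) * (c : K).
Proof. by rewrite /simple_scale jac_repr_triv. Qed.

Fact simple_scaleA x y c :
  simple_scale x (simple_scale y c) = simple_scale (x * y) c.
Proof.
rewrite -[x]jac_reprK -[y]jac_reprK -jac_piM !simple_scale_pi.
by rewrite cpa_triv_mul mulrA.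
Qed.
Fact simple_scale1 : left_id 1 simple_scale.
Proof. by move=> c; rewrite -jac_pi1 simple_scale_pi cpa1E mul1r. Qed.
Fact simple_scaleDr : right_distributive simple_scale +%R.
Proof. by move=> x c d; apply: mulrDr. Qed.
Fact simple_scaleDl c : {morph simple_scale^~ c : x y / x + y}.
Proof.
move=> x y; rewrite -[x]jac_reprK -[y]jac_reprK -jac_piD !simple_scale_pi.
exact: mulrDl.
Qed.

HB.instance Definition _ :=
  GRing.Zmodule_isLmodule.Build 'J(P) Sk simple_scaleA simple_scale1
    simple_scaleDr simple_scaleDl.

Lemma simple_fg : finitely_generated (Sk : lmodType 'J(P)).
Proof.
exists 1%N, (fun=> (1 : K) : Sk) => c.
exists (fun=> jac_pi (qp_pot P) ((c : K) *: (1 : A))).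
rewrite big_ord1; apply/esym; rewrite -[LHS]/(simple_scale _ _).
by rewrite simple_scale_pi cpaZE cpa1E !mulr1.
Qed.

Definition simple_mod : fgmod 'J(P) := FGMod simple_fg.

End Simples.

(* Main.v *)
Require Import Defs.
From mathcomp Require Import all_boot all_algebra.
From HB Require Import structures.
From mathcomp Require Import boolp.
From Stdlib Require List.

(** Write S and S' for the simple modules at k, F and G for the functors
    F_k^+ and F_k^-, and N_1 = S, N_2, .., N_m for the given sequence.

    Since N_1 = S is first, the modules N_2, .., N_m lie in S^perp, where F is an
    equivalence onto ^perp S'. Hence the F N_i are bricks with the same
    vanishing of Hom as the N_i, and Hom (F N_i, S') = 0 because F takes values in
    ^perp S' there.

    Generation amounts to this: a module Y such that Hom (F N_i, Y) = 0 for all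
    i >= 2 and Hom (S', Y) = 0 is zero ([reflection_gen]). By adjunction
    Hom (N_i, G Y) = 0 for i >= 2, and also Hom (S, G Y) = Hom (F S, Y) = 0, so
    G Y is in the perpendicular of N_1, .., N_m, i.e., G Y = 0. Every T in ^perp S'
    is isomorphic to F (G T), so Hom (T, Y) = Hom (G T, G Y) = 0. A
    finite dimensional Y that receives no map from ^perp S' is a successive
    extension of copies of S': if it is not zero, its identity shows that it
    is not in ^perp S', so it has a nonzero map to S', whose kernel is smaller and
    of the same kind. Such a Y contains S' unless it is zero ([dim1_socle]);
    as Hom (S', Y) = 0, it is zero.

    For maximality, a brick B inserted after S' would be such a Y, which is
    absurd. A brick B inserted before S' lies in ^perp S', and then G B is a brick
    that could be inserted at the corresponding place, after S, of the original
    sequence. *)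

Set Implicit Arguments.
Unset Strict Implicit.
Unset Printing Implicit Defensive.

Import GRing.Theory.
Local Open Scope ring_scope.

(** * Linear maps, isomorphisms and vanishing of Hom *)

Section LinearMaps.
Variable R : pzRingType.

Lemma linear_ext (X Y : lmodType R) (f g : {linear X -> Y}) : f =1 g -> f = g.
Proof.
case: f g => [f fL] [g gL] /= /funext fg; case: g / fg gL => gL.
congr GRing.Linear.Pack; case: fL gL => [[[f1 f2]] [f3]] [[[g1 g2]] [g3]].
by congr (GRing.Linear.Class _ _); congr (_ _); apply: Prop_irrelevance.
Qed.

(** This gives a linear structure to maps that are defined inside a proof. *)
Lemma linear_lift (X Y : lmodType R) (f : X -> Y) :
  linear f -> exists g : {linear X -> Y}, g =1 f.
Proof.
move=> fL; pose fM := GRing.isLinear.Build R X Y *:%R f fL.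
pose g : {linear X -> Y} := HB.pack f fM.
by exists g.
Qed.

Lemma linear_inverse (X Y : lmodType R) (f : {linear X -> Y}) :
  bijective f -> exists g : {linear Y -> X}, cancel f g /\ cancel g f.
Proof.
case=> g fK gK; have [h hE] := linear_lift (can2_linear fK gK).
by exists h; split=> x; rewrite hE.
Qed.

Implicit Types X Y Z M N : fgmod R.

Lemma fg_iso_sym X Y : fg_iso X Y -> fg_iso Y X.
Proof.
by case=> f /linear_inverse[g [fK gK]]; exists g; exists f.
Qed.

Lemma hom0_isol X X' Y : fg_iso X X' -> hom0 X Y -> hom0 X' Y.
Proof.
case=> f [g fK gK] XY h x.
by rewrite -(gK x); exact: (XY (h \o f : {linear X -> Y})).
Qed.

Lemma hom0_isor X Y Y' : fg_iso Y Y' -> hom0 X Y -> hom0 X Y'.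
Proof.
case=> f /linear_inverse[g [fK gK]] XY h x.
have /= gh0 := XY (g \o h : {linear X -> Y}) x.
by rewrite -(gK (h x)) gh0 linear0.
Qed.

Lemma fg_eq0P Y : fg_eq0 Y <-> hom0 Y Y.
Proof.
split=> [Y0 f x|YY x]; first exact: Y0.
exact: (YY (idfun : {linear Y -> Y})).
Qed.

(** A nonzero perpendicular object would map to itself by the identity. *)
Lemma tors_allP N : (forall X, tors N X) <-> forall Y, rperp N Y -> fg_eq0 Y.
Proof.
split=> [Ntors Y NY|N0 X Y NY f x]; first exact/fg_eq0P/Ntors.
exact: N0.
Qed.

Lemma hom0_dsuml X1 X2 Y :
  hom0 (fg_dsum X1 X2) Y <-> hom0 X1 Y /\ hom0 X2 Y.
Proof.
split=> [XY|[X1Y X2Y] f [x1 x2]].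
  split=> f x.
    exact: (XY (f \o fst : {linear (X1 * X2)%type -> Y}) (x, 0)).
  exact: (XY (f \o snd : {linear (X1 * X2)%type -> Y}) (0, x)).
have in1L : linear (fun x : X1 => (x, 0) : X1 * X2).
  by move=> a x y; congr pair; rewrite /= scaler0 addr0.
have in2L : linear (fun x : X2 => (0, x) : X1 * X2).
  by move=> a x y; congr pair; rewrite /= scaler0 addr0.
have [[g1 g1E] [g2 g2E]] := (linear_lift in1L, linear_lift in2L).
have -> : (x1, x2) = g1 x1 + g2 x2.
  by rewrite g1E g2E; congr pair; rewrite /= ?addr0 ?add0r.
rewrite linearD.
have /= -> := X1Y (f \o g1 : {linear X1 -> Y}) x1.
by have /= -> := X2Y (f \o g2 : {linear X2 -> Y}) x2; rewrite addr0.
Qed.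

Lemma hom0_bigdsuml (s : seq (fgmod R)) Y :
  hom0 (fg_bigdsum s) Y <-> List.Forall (fun X => hom0 X Y) s.
Proof.
elim: s => [|X s IHs] /=.
  split=> [//|_ f x]; suff -> : x = 0 by rewrite linear0.
  by apply/rowP => -[].
rewrite List.Forall_cons_iff -IHs; exact: hom0_dsuml.
Qed.

Lemma brick_bij M (f : {linear M -> M}) :
  brick M -> (exists x, f x != 0) -> bijective f.
Proof. by case=> _ /[apply] -[g [fK gK]]; exists g. Qed.

Lemma brick_neq0 M : brick M -> ~ fg_eq0 M.
Proof. by case=> -[x /eqP xn0] _ M0; apply/xn0/M0. Qed.

End LinearMaps.

(** * Insertion into a list of pairwise related objects *)

Section OrdPairs.
Variables (T : Type) (r : T -> T -> Prop).
Local Notation pairs := (List.ForallOrdPairs r).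

Lemma ForallOrdPairs_cons x s :
  pairs (x :: s) <-> List.Forall (r x) s /\ pairs s.
Proof.
by split=> [H|[]]; [inversion H | apply: List.FOP_cons].
Qed.

Lemma ForallOrdPairs_insert x s1 s2 :
  pairs (s1 ++ x :: s2) <->
  pairs (s1 ++ s2) /\ List.Forall (r^~ x) s1 /\ List.Forall (r x) s2.
Proof.
elim: s1 => [|y s1 IHs] /=.
  by rewrite ForallOrdPairs_cons List.Forall_nil_iff; tauto.
rewrite !ForallOrdPairs_cons IHs !List.Forall_app !List.Forall_cons_iff.
by tauto.
Qed.

Lemma ForallOrdPairs_map (U : Type) (r' : U -> U -> Prop) (f : T -> U) s :
  (forall x y, List.In x s -> List.In y s -> r x y -> r' (f x) (f y)) ->
  pairs s -> List.ForallOrdPairs r' (map f s).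
Proof.
elim: s => [|x s IHs] rr' /=; first by move=> _; apply: List.FOP_nil.
rewrite ForallOrdPairs_cons => -[xs ss]; apply: List.FOP_cons.
  apply/List.Forall_map/List.Forall_forall => y ys.
  apply: rr'; [by left|by right|].
  by move/List.Forall_forall: xs; apply.
by apply: IHs => // y z ys zs; apply: rr'; right.
Qed.

End OrdPairs.

(** * Additive functors and adjunctions *)

Section Functors.
Variables (R R' : pzRingType) (F : add_functor R R').

Lemma fmap_eq0 (X Y : fgmod R) (f : {linear X -> Y}) :
  (forall x, f x = 0) -> forall x, fmap F f x = 0.
Proof.
move=> f0 x; apply: (@addrI _ (fmap F f x)); rewrite addr0.
have /= <- := @fmap_add _ _ F X Y f f x.
suff -> : (f \+ f : {linear X -> Y}) = f by [].
by apply: linear_ext => y /=; rewrite f0 addr0.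
Qed.

Lemma fmap_bij (X Y : fgmod R) (f : {linear X -> Y}) :
  bijective f -> bijective (fmap F f).
Proof.
case/linear_inverse=> g [fK gK].
have cmpK (U W : fgmod R) (u : {linear U -> W}) (v : {linear W -> U}) :
    cancel u v -> cancel (fmap F u) (fmap F v).
  move=> uK x; have /= <- := @fmap_comp _ _ F _ _ _ v u x.
  suff -> : (v \o u : {linear U -> U}) = idfun by apply: fmap_id.
  exact: linear_ext.
by exists (fmap F g); apply: cmpK.
Qed.

Lemma fobj_eq0 (X : fgmod R) : fg_eq0 X -> fg_eq0 (F X).
Proof. by move=> X0 x; have /= <- := @fmap_id _ _ F X x; apply: fmap_eq0. Qed.

End Functors.

Section Equivalences.
Variables (R R' : pzRingType) (F : add_functor R R') (G : add_functor R' R).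

(** A bijection between sets of morphisms matches the zero morphism with the
    zero morphism as soon as it is natural in the target: the zero morphism of
    Hom (F X, Y) factors through the zero endomorphism of Y. *)
Lemma adjoint_hom0 (X : fgmod R) (Y : fgmod R') :
  left_adjoint F G -> hom0 (F X) Y <-> hom0 X (G Y).
Proof.
case=> phi [phi_bij phi_nat].
have [psi phiK psiK] := phi_bij X Y.
pose z : {linear F X -> Y} := \0.
have phi0 x : phi X Y z x = 0.
  have := phi_nat X X Y Y (idfun : {linear X -> X}) (\0 : {linear Y -> Y}) z x.
  rewrite [RHS](_ : _ = 0); last exact: fmap_eq0.
  by move=> <-; congr (phi X Y _ x); apply: linear_ext.
split=> [XY u x|XY h x].
  by rewrite -(psiK u) (_ : psi u = z) //; apply: linear_ext => y; apply: XY.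
suff -> : h = z by [].
by apply: (can_inj phiK); apply: linear_ext => y; rewrite phi0; apply: XY.
Qed.

Variables (C : fgmod R -> Prop) (C' : fgmod R' -> Prop).
Hypotheses (FC : maps_into F C C')
  (GF : natural_retract F G C) (FG : natural_retract G F C').

Lemma retract_iso X : C X -> fg_iso X (G (F X)).
Proof. by case: GF => eta [eta_bij _] CX; exists (eta X); apply: eta_bij. Qed.

(** Conjugation by the units of the two natural isomorphisms turns an
    endomorphism g of F X into an endomorphism f of X, with G g and f
    conjugate, and F (G g) and g conjugate. As additive functors preserve zero
    and bijective maps, f is nonzero if g is, and g is bijective if f is. *)
Lemma equivalence_brick X : C X -> brick X -> brick (F X).
Proof.
move=> CX brX; have C'FX := FC CX.
have [[eta [eta_bij eta_nat]] [eps [eps_bij eps_nat]]] := (GF, FG).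
split.
  apply: contrapT => FX0; apply: (brick_neq0 brX).
  have /fobj_eq0 GFX0 : fg_eq0 (F X).
    by move=> x; apply/eqP; apply: contrapT => /negP xn0; apply: FX0; exists x.
  by move=> x; apply: (bij_inj (eta_bij X CX)); rewrite linear0; apply: GFX0.
move=> g [x gx].
have eps_comp y : fmap F (fmap G g) (eps (F X) y) = eps (F X) (g y).
  by apply/esym; apply: (eps_nat (F X) (F X) g).
have [eta' [etaK eta'K]] := linear_inverse (eta_bij X CX).
have [f fdef] : exists f : {linear X -> X}, f =1 eta' \o fmap G g \o eta X.
  by exists (eta' \o (fmap G g \o eta X)).
have fE : fmap G g =1 eta X \o f \o eta'.
  by move=> y; rewrite /= fdef /= !eta'K.
have [y fy] : exists y, f y != 0.
  apply: contrapT => f0; move/eqP: gx; apply.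
  apply: (bij_inj (eps_bij _ C'FX)); rewrite linear0 -eps_comp.
  apply: fmap_eq0 => y; rewrite fE /=.
  suff -> : f (eta' y) = 0 by rewrite linear0.
  by apply/eqP; apply: contrapT => /negP fy; apply: f0; exists (eta' y).
have f_bij : bijective f by apply: (brick_bij brX); exists y.
have Gg_bij : bijective (fmap G g).
  apply: (eq_bij (f := eta X \o f \o eta')) => [|z]; last by rewrite fE.
  apply: bij_comp; first by apply: bij_comp => //; apply: eta_bij.
  by exists (eta X).
have [eps' epsK eps'K] := eps_bij _ C'FX.
apply: linear_inverse.
apply: (eq_bij (f := eps' \o fmap F (fmap G g) \o eps (F X))) => [|z].
  apply: bij_comp; last exact: eps_bij.
  by apply: bij_comp; [exists (eps (F X)) | apply: fmap_bij].
by rewrite /= eps_comp epsK.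
Qed.

End Equivalences.

(** * Sequences under a reflection *)

Section Reflection.
Variables (R R' : pzRingType) (S : fgmod R) (S' : fgmod R').
Variables (F : add_functor R R') (G : add_functor R' R).
Hypothesis FG_refl : reflection_functors S S' F G.
Hypothesis S'_brick : brick S'.
(* For finite dimensional modules, the torsion-free objects for the torsion class
   ^perp S' are filtered by copies of S'; so S' embeds in them unless they are
   zero. *)
Hypothesis S'_detects : forall Y : fgmod R',
  (forall T, lperp S' T -> hom0 T Y) -> rperp S' Y -> fg_eq0 Y.

Let adj := refl_adjoint FG_refl.

Lemma reflection_hom0 X Y : rperp S Y -> hom0 (F X) (F Y) <-> hom0 X Y.
Proof.
move=> SY; rewrite (adjoint_hom0 _ _ adj).
have YGFY := retract_iso (refl_inv FG_refl) SY.
by split; apply: hom0_isor => //; apply: fg_iso_sym.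
Qed.

Lemma reflection_hom0' X Y : lperp S' X -> rperp S Y ->
  hom0 X (F Y) <-> hom0 (G X) Y.
Proof.
move=> XS' SY; rewrite -reflection_hom0 //.
have XFGX := retract_iso (refl_inv' FG_refl) XS'.
by split; apply: hom0_isol => //; apply: fg_iso_sym.
Qed.

(** If G Y = 0 then Y is torsion-free for the torsion class ^perp S': an object
    T of this class is F (G T), so that Hom (T, Y) = Hom (G T, G Y). *)
Lemma reflection_detects0 Y : fg_eq0 (G Y) -> rperp S' Y -> fg_eq0 Y.
Proof.
move=> GY0; apply: S'_detects => T TS'.
apply: (hom0_isol (fg_iso_sym (retract_iso (refl_inv' FG_refl) TS'))).
by apply/(adjoint_hom0 _ _ adj) => f x; apply: GY0.
Qed.

(** By adjunction, since F S = 0. *)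
Lemma reflection_perp Y : hom0 S (G Y).
Proof.
apply/(adjoint_hom0 _ _ adj) => f x.
suff -> : x = 0 by rewrite linear0.
apply: (refl_copies FG_refl); exists 1%N => /=.
have in1L : linear (fun x : S => (x, 0) : S * fg_zero R).
  by move=> a u v; congr pair; rewrite /= scaler0 addr0.
have [g gE] := linear_lift in1L; exists g; exists fst => [u|[u v]].
  by rewrite gE.
by rewrite gE; congr pair; apply/rowP => -[].
Qed.

Variables (N : fgmod R) (s : seq (fgmod R)).
Hypothesis N_iso : fg_iso N S.
Hypothesis s_complete : complete_fho (N :: s).

Let s_perp X : List.In X s -> rperp S X.
Proof.
case: s_complete => _ /ForallOrdPairs_cons[/List.Forall_forall Ns _] _ _.
by move/Ns; apply: hom0_isol.
Qed.

(** G Y is perpendicular to the whole of the original sequence, whose torsion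
    class is everything; so G Y = 0. *)
Lemma reflection_gen Y :
  List.Forall (fun X => hom0 (F X) Y) s -> rperp S' Y -> fg_eq0 Y.
Proof.
move=> sY; apply: reflection_detects0.
have [_ _ _ /tors_allP] := s_complete; apply.
apply/hom0_bigdsuml; apply: List.Forall_cons.
  by apply: (hom0_isol (fg_iso_sym N_iso)); apply: reflection_perp.
by apply: List.Forall_impl sY => X; rewrite (adjoint_hom0 _ _ adj).
Qed.

Lemma reflection_complete_fho : complete_fho (rcons (map F s) S').
Proof.
have [s_brick s_orth s_max s_gen] := s_complete.
have s_orth' : hom_orthogonal s by case/ForallOrdPairs_cons: s_orth.
rewrite -cats1; split.
- apply/List.Forall_app; split; last by apply: List.Forall_cons.
  apply/List.Forall_map/List.Forall_forall => X sX.
  apply: (equivalence_brick (refl_perp FG_refl) (refl_inv FG_refl)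
            (refl_inv' FG_refl)); first exact: s_perp.
  by move/List.Forall_forall: s_brick; apply; right.
- apply/ForallOrdPairs_insert; rewrite cats0; split; last split => //.
    apply: ForallOrdPairs_map s_orth' => X Y sX sY XY.
    by apply/reflection_hom0 => //; apply: s_perp.
  apply/List.Forall_map/List.Forall_forall => X sX.
  exact/(refl_perp FG_refl)/s_perp.
- move=> s1 s2 B; case/lastP: s2 => [|s2 S''].
    (* B comes after S': then it is perpendicular to the new sequence. *)
    rewrite cats0 => <- brB _ /ForallOrdPairs_insert[_ [+ _]].
    case/List.Forall_app => /List.Forall_map sB /List.Forall_cons_iff[S'B _].
    exact/(brick_neq0 brB)/reflection_gen.
  (* B comes before S': the original sequence is N :: t1 ++ t2, and G B can be
     inserted between t1 and t2. *)
  rewrite cats1 -rcons_cat => /rcons_inj[] sE <- brB _.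
  have [t1 [t2 [st [t1E t2E]]]] := List.map_eq_app _ _ _ _ sE.
  rewrite -t1E -t2E => /ForallOrdPairs_insert[_ [t1B]].
  rewrite -cats1 => /List.Forall_app[Bt2 /List.Forall_cons_iff[BS' _]].
  have GB_brick : brick (G B).
    exact: (equivalence_brick (refl_perp' FG_refl) (refl_inv' FG_refl)
              (refl_inv FG_refl)).
  apply: (s_max (N :: t1) t2 (G B)) => //; first by rewrite st.
  apply/ForallOrdPairs_insert; split; first by rewrite st in s_orth.
  split.
    apply: List.Forall_cons.
      by apply: (hom0_isol (fg_iso_sym N_iso)); apply: reflection_perp.
    move/List.Forall_map: t1B; apply: List.Forall_impl => X.
    by rewrite (adjoint_hom0 _ _ adj).
  apply/List.Forall_forall => X t2X.
  move/List.Forall_map/List.Forall_forall: Bt2 => /(_ X t2X) BFX.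
  apply/reflection_hom0' => //; apply: s_perp; rewrite st.
  by apply: List.in_or_app; right.
- apply/tors_allP => Y /hom0_bigdsuml/List.Forall_app[].
  move=> /List.Forall_map sY /List.Forall_cons_iff[S'Y _].
  exact: reflection_gen.
Qed.

End Reflection.

(** * Finite dimensional modules *)

Section Kernel.
Variables (R : pzRingType) (X Y : lmodType R) (f : {linear X -> Y}).

Definition ker_pred : {pred X} := fun x => f x == 0.

Fact ker_submod_closed : subsemimod_closed ker_pred.
Proof.
split; first split=> [|x y /eqP fx /eqP fy]; rewrite ?unfold_in ?linear0 //.
  by apply/eqP; rewrite linearD fx fy addr0.
by move=> a x /eqP fx; apply/eqP; rewrite linearZ /= fx scaler0.
Qed.

HB.instance Definition _ :=
  GRing.isSubmodClosed.Build R X ker_pred ker_submod_closed.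

Definition kernel : Type := {x : X | x \in ker_pred}.

HB.instance Definition _ := SubType.on kernel.
HB.instance Definition _ := Choice.on kernel.
HB.instance Definition _ := [SubChoice_isSubLmodule of kernel by <:].

Definition kernel_mk x (fx : f x = 0) : kernel :=
  exist (fun y => y \in ker_pred) x (introT eqP fx).

Lemma kernelP (x : kernel) : f (val x) = 0.
Proof. exact/eqP/(valP x). Qed.

End Kernel.

(** Here K-dimension is measured along a ring morphism from K to R, and S is a
    module of K-dimension one. *)
Section OneDim.
Variables (K : fieldType) (R : pzRingType) (iota : {rmorphism K -> R}).

(** An upper bound on the K-dimension of M. *)
Definition kspanned (n : nat) (M : lmodType R) : Prop :=
  exists g : 'I_n -> M, forall x, exists c : 'I_n -> K,
    x = \sum_i iota (c i) *: g i.

Lemma kspanned_fg n M : kspanned n M -> finitely_generated M.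
Proof.
case=> g gP; exists n, g => x; have [c ->] := gP x.
by exists (iota \o c).
Qed.

Variable S : fgmod R.
Hypothesis S_neq0 : exists s : S, s != 0.
Hypothesis S_dim1 : forall s t : S, s != 0 -> exists c, t = iota c *: s.

Lemma dim1_inj (X : lmodType R) (f : {linear S -> X}) :
  (exists x, f x != 0) -> injective f.
Proof.
case=> x fx; apply: raddf_inj => y fy0; apply/eqP/negPn/negP => yn0.
have [c xE] := S_dim1 x yn0.
by move: fx; rewrite xE linearZ /= fy0 scaler0 eqxx.
Qed.

Lemma dim1_surj (X : lmodType R) (f : {linear X -> S}) :
  (exists x, f x != 0) -> forall y, exists x, f x = y.
Proof.
case=> x fx y; have [c ->] := S_dim1 y fx.
by exists (iota c *: x); rewrite linearZ.
Qed.

Lemma inj_surj_bij (X Y : lmodType R) (f : {linear X -> Y}) :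
  injective f -> (forall y, exists x, f x = y) -> bijective f.
Proof.
move=> f_inj /choice[g gK]; exists g => // x; exact/f_inj/gK.
Qed.

Lemma dim1_brick : brick S.
Proof.
split=> // f fn0; apply: linear_inverse; apply: inj_surj_bij.
  exact: dim1_inj.
exact: dim1_surj.
Qed.

(** If f g_0 <> 0, subtracting from each other generator g_i the multiple of g_0
    on which f takes the same value gives n elements of the kernel. They span it:
    an element of the kernel is a combination of them up to a multiple b g_0,
    and f kills this multiple only if b = 0. *)
Lemma kspanned_kernel n (M : lmodType R) (f : {linear M -> S}) :
  (exists x, f x != 0) -> kspanned n.+1 M -> kspanned n (kernel f).
Proof.
move=> [x0 fx0] [g gP].
have [i0 fg0] : exists i, f (g i) != 0.
  apply: contrapT => fg; move: fx0; have [c ->] := gP x0.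
  rewrite linear_sum big1 ?eqxx // => i _; rewrite linearZ /=.
  have [->|] := eqVneq (f (g i)) 0; first by rewrite scaler0.
  by move=> fgi; case: fg; exists i.
have /choice[c cE] : forall i, exists c, f (g i) = iota c *: f (g i0).
  by move=> i; apply: S_dim1.
have hP i : f (g i - iota (c i) *: g i0) = 0.
  by rewrite linearB linearZ /= cE subrr.
exists (fun j => kernel_mk (hP (lift i0 j))) => x.
have [a xE] := gP (val x); exists (fun j => a (lift i0 j)).
apply: val_inj; rewrite raddf_sum /=.
pose b := a i0 + \sum_j a (lift i0 j) * c (lift i0 j).
have vx : val x = iota b *: g i0 + \sum_j iota (a (lift i0 j)) *:
    (g (lift i0 j) - iota (c (lift i0 j)) *: g i0).
  rewrite {1}xE (bigD1_ord i0) //= /b rmorphD scalerDl -addrA; congr (_ + _).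
  rewrite rmorph_sum scaler_suml -big_split; apply: eq_bigr => j _ /=.
  by rewrite scalerBr scalerA -rmorphM addrCA subrr addr0.
have fb0 : iota b *: f (g i0) = 0.
  have := kernelP x; rewrite vx linearD linear_sum big1 ?addr0 => [|j _].
    by rewrite linearZ.
  by rewrite linearZ /= hP scaler0.
have b0 : b = 0.
  apply: contraNeq fg0 => bn0.
  by rewrite -[f _]scale1r -(rmorph1 iota) -(mulVf bn0) rmorphM -scalerA fb0
    scaler0.
by rewrite vx b0 rmorph0 scale0r add0r.
Qed.

(** A nonzero Y that receives no map from ^perp S has a nonzero map to S, as
    otherwise Y itself would be in ^perp S. Its kernel inherits both hypotheses, so
    it is zero by induction on the dimension; then Y is isomorphic to S, which
    contradicts Hom (S, Y) = 0. *)
Lemma dim1_socle n (Y : fgmod R) : kspanned n Y ->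
  (forall T, lperp S T -> hom0 T Y) -> rperp S Y -> fg_eq0 Y.
Proof.
elim: n Y => [|n IHn] Y Yn YS SY.
  by move=> y; have [g gP] := Yn; have [c ->] := gP y; rewrite big_ord0.
apply: contrapT => Yn0.
have [f [x0 fx0]] : exists (f : {linear Y -> S}) x, f x != 0.
  apply: contrapT => f0; apply: Yn0; apply/fg_eq0P/YS => f x.
  by apply/eqP; apply: contrapT => /negP fx; apply: f0; exists f, x.
have kern : kspanned n (kernel f) by apply: kspanned_kernel => //; exists x0.
pose Z := FGMod (kspanned_fg kern).
have Z0 : fg_eq0 Z.
  apply: (IHn Z kern) => [T TS h x|h x].
    exact/val_inj/(YS T TS (val \o h : {linear T -> Y}) x).
  exact/val_inj/(SY (val \o h : {linear S -> Y}) x).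
have f_inj : injective f.
  apply: raddf_inj => y fy.
  by have := Z0 (kernel_mk fy) => /(congr1 val) /=.
have [|g [fK gK]] := @linear_inverse R Y S f.
  by apply: inj_surj_bij f_inj _; apply: dim1_surj; exists x0.
by move: fx0; rewrite -[x0]fK SY linear0 eqxx.
Qed.

End OneDim.

(** * Jacobian algebras *)

Section JacobianSimple.
Variables (K : fieldType) (V : finType) (P : QP K V) (k : V).

Definition jac_const (c : K) : 'J(P) := jac_pi (qp_pot P) (c *: (1 : cpa K P)).

Fact jac_const_zmod : zmod_morphism jac_const.
Proof. by move=> a b; rewrite /jac_const !jac_piZ scalerBl. Qed.

Fact jac_const_monoid : monoid_morphism jac_const.
Proof.
split=> [|a b]; first by rewrite /jac_const scale1r.
by rewrite /jac_const -jac_piM -cpa_scalerAl mul1r scalerA.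
Qed.

HB.instance Definition _ :=
  GRing.isZmodMorphism.Build K 'J(P) jac_const jac_const_zmod.
HB.instance Definition _ :=
  GRing.isMonoidMorphism.Build K 'J(P) jac_const jac_const_monoid.

Lemma jac_constE c (x : 'J(P)) : jac_const c * x = c *: x.
Proof.
by rewrite -[x]jac_reprK -jac_piM -cpa_scalerAl mul1r jac_piZ.
Qed.

Lemma simple_neq0 : exists s : simple_mod P k, s != 0.
Proof. by exists (1 : K); apply: oner_neq0. Qed.

Lemma simple_dim1 (s t : simple_mod P k) :
  s != 0 -> exists c, t = jac_const c *: s.
Proof.
move=> sn0; exists ((t : K) / (s : K)).
rewrite -[RHS]/(simple_scale _ _) simple_scale_pi cpaZE cpa1E mulr1.
by rewrite divfK.
Qed.

(** The products of the generators of M over the algebra with a spanning family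
    of the algebra over K. *)
Lemma fgmod_kspanned (M : fgmod 'J(P)) :
  finitely_generated ('J(P) : lmodType K) -> exists n, kspanned jac_const n M.
Proof.
case=> m [e eP]; have [n [g gP]] := fgmodP M.
exists #|{: 'I_n * 'I_m}|, (fun u => e (enum_val u).2 *: g (enum_val u).1) => x.
have [c ->] := gP x; have /choice[d dE] := fun i => eP (c i).
exists (fun u => d (enum_val u).1 (enum_val u).2).
rewrite -(big_enum_val (fun u => jac_const (d u.1 u.2) *: (e u.2 *: g u.1))) /=.
rewrite -(pair_big xpredT xpredT
  (fun i j => jac_const (d i j) *: (e j *: g i))) /=.
apply: eq_bigr => i _; rewrite dE scaler_suml; apply: eq_bigr => j _.
by rewrite scalerA jac_constE.
Qed.

End JacobianSimple.

Theorem theorem4p6 (K : fieldType) (V : finType) (P P' : QP K V) (k : V)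
    (P_nondeg : nondegenerate_QP P)
    (P'_mut : is_mutation k P P')
    (J_fd : finitely_generated ('J(P) : lmodType K))
    (J'_fd : finitely_generated ('J(P') : lmodType K))
    (Fplus : add_functor 'J(P) 'J(P'))
    (Fminus : add_functor 'J(P') 'J(P))
    (F_refl : reflection_functors (simple_mod P k) (simple_mod P' k) Fplus Fminus)
    (N1 : fgmod 'J(P)) (Ns : seq (fgmod 'J(P)))
    (N1_simple : fg_iso N1 (simple_mod P k))
    (N_complete : complete_fho (N1 :: Ns)) :
  complete_fho (rcons (map Fplus Ns) (simple_mod P' k)).
Proof.
apply: reflection_complete_fho F_refl _ _ _ _ N1_simple N_complete.
  exact: dim1_brick (simple_neq0 P' k) (@simple_dim1 _ _ P' k).
move=> Y; have [n Yn] := fgmod_kspanned Y J'_fd.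
exact: dim1_socle (@simple_dim1 _ _ P' k) _ _ Yn.
Qed.
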